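(* A regular dessin is primitive and faithful if and only if it is (isomorphic to) a generalised Paley dessin.
   Context: Regular dessins are described combinatorially: a regular dessin $\mathcal D$ is determined up to isomorphism by a triple $(G;x,y)$ where $G$ is a finite group generated by $x$ and $y$; two triples $(G;x,y)$ and $(G';x',y')$ determine isomorphic dessins if and only if some group isomorphism $G\to G'$ sends $x\mapsto x'$, $y\mapsto y'$. Put $z=(xy)^{-1}$. The black vertices, white vertices and face-centres of $\mathcal D$ are the left cosets of $\langle x\rangle$, $\langle y\rangle$, $\langle z\rangle$ in $G$, the edges are the elements of $G$, and the automorphism group ${\rm Aut}\,\mathcal D\cong G$ acts on all of these by left multiplication (regularly on the edges). A regular dessin is primitive (resp. faithful) if ${\rm Aut}\,\mathcal D$ acts primitively (resp. faithfully) on the set of black vertices. Generalised Paley dessins: let $p$ be a prime, $d\ge1$, $q=p^d$, and ${\mathbb F}_q$ the field of order $q$. Let ${\rm AGL}_1(q)$ be the group of maps $t\mapsto at+b$ ($a\in{\mathbb F}_q^*$, $b\in{\mathbb F}_q$) and $T=\{t\mapsto t+b\}$ its translation subgroup. For a subgroup $S\le{\mathbb F}_q^*$ of order $n$, identified with $\{t\mapsto at: a\in S\}$, let $G_S=\{t\mapsto at+b: a\in S, b\in{\mathbb F}_q\}=T\rtimes S$. Suppose either $n=d=1$, or $n>1$ and $p$ has multiplicative order $d$ modulo $n$. Let $x$ be a generator of $S$ and $y$ any element of $G_S\setminus S$ (then $G_S=\langle x,y\rangle$). The regular dessin given by $(G_S;x,y)$ is a generalised Paley dessin (of valency $n$,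 field characteristic $p$, dimension $d$). *)

(* Defs.v *)
From HB Require Import structures.
From mathcomp Require Import all_boot all_order all_algebra.
From mathcomp Require Import all_fingroup all_solvable all_field.

Set Implicit Arguments.
Unset Strict Implicit.
Unset Printing Implicit Defensive.

Import GRing.Theory.
Local Open Scope group_scope.

Section RegularDessins.

Implicit Types gT rT : finGroupType.

Definition regular_dessin gT (G : {group gT}) (x y : gT) : Prop :=
  <<[set x; y]>> = G.

Definition dessin_iso gT (G : {group gT}) (x y : gT)
    rT (H : {group rT}) (x' y' : rT) : Prop :=
  exists f : {morphism G >-> rT}, [/\ isom G H f, f x = x' & f y = y'].

Definition black_vertices gT (G : {group gT}) (x : gT) : {set {set gT}} :=
  lcosets <[x]> G.

(* MathComp actions are right actions, so left multiplication by g is the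
   action of g^-1. *)
Definition lmul_set gT (A : {set gT}) (g : gT) : {set gT} := g^-1 *: A.

Fact lmul_set1 gT : (@lmul_set gT)^~ 1 =1 id.
Proof. by move=> A; rewrite /lmul_set invg1 lcoset1. Qed.

Fact lmul_setM gT (A : {set gT}) : act_morph (@lmul_set gT) A.
Proof. by move=> g h; rewrite /lmul_set invMg lcosetM. Qed.

Definition lmul_action gT : {action gT &-> {set gT}} :=
  TotalAction (@lmul_set1 gT) (@lmul_setM gT).

(* A primitive group is understood to have degree > 1, i.e., its point
   stabilisers are maximal proper subgroups. MathComp's [primitive _, on _ | _]
   also holds on a one-point set, which here would admit the dessin with
   trivial automorphism group. *)
Definition primitive_dessin gT (G : {group gT}) (x : gT) : Prop :=
  1 < #|black_vertices G x| /\
  [primitive G, on black_vertices G x | lmul_action gT].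

Definition faithful_dessin gT (G : {group gT}) (x : gT) : Prop :=
  [faithful G, on black_vertices G x | lmul_action gT].

End RegularDessins.

Section GeneralisedPaley.

Variable F : finFieldType.

Definition affine_map (a : {unit F}) (b : F) (t : F) : F :=
  (FinRing.uval a * t + b)%R.

Fact affine_map_inj a b : injective (affine_map a b).
Proof. by move=> t u /addIr/mulrI; apply; apply: (valP a). Qed.

Definition affine_perm a b : {perm F} := perm (@affine_map_inj a b).

(* Permutations are composed from left to right in {perm F}. The opposite
   convention gives the same class of dessins: inversion is an isomorphism onto
   the opposite group, preserving the conditions imposed below on x and y. *)
Fact affine_permM a b a' b' :
  affine_perm a b * affine_perm a' b' =
    affine_perm (a' * a) (FinRing.uval a' * b + b')%R.
Proof.
apply/permP=> t; rewrite permM !permE /affine_map /=.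
by rewrite mulrDr mulrA addrA.
Qed.

Fact affine_perm1 : affine_perm 1 0%R = 1.
Proof. by apply/permP=> t; rewrite permE perm1 /affine_map mul1r addr0. Qed.

Variable S : {group {unit F}}.

Definition scalings : {set {perm F}} := [set affine_perm a 0%R | a in S].

Definition affine_set : {set {perm F}} :=
  [set affine_perm a b | a in S, b in [set: F]].

Fact affine_group_set : group_set affine_set.
Proof.
apply/group_setP; split.
  by apply/imset2P; exists 1 0%R; rewrite ?group1 ?inE ?affine_perm1.
move=> _ _ /imset2P[a b Sa _ ->] /imset2P[a' b' Sa' _ ->].
by rewrite affine_permM; apply: imset2_f; rewrite ?groupM ?inE.
Qed.

Definition affine_group : {group {perm F}} := Group affine_group_set.

End GeneralisedPaley.

Definition has_mult_order_mod (n p d : nat) : Prop :=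
  exists2 u : {unit 'Z_n}, FinRing.uval u = p%:R%R & #[u] = d.

Definition generalised_Paley (p d n : nat) (F : finFieldType)
    (S : {group {unit F}}) (x y : {perm F}) : Prop :=
  [/\ prime p, 1 <= d, #|F| = (p ^ d)%N & #|S| = n] /\
  [/\ (n = 1%N /\ d = 1%N) \/ (1 < n /\ has_mult_order_mod n p d),
      generator (scalings S) x & y \in affine_group S :\: scalings S].

Definition is_generalised_Paley (gT : finGroupType) (G : {group gT})
    (x y : gT) : Prop :=
  exists p d n (F : finFieldType) (S : {group {unit F}}) (x' y' : {perm F}),
    generalised_Paley p d n S x' y' /\
    dessin_iso G x y (affine_group S) x' y'.

(* Main.v *)
Require Import Defs.
From mathcomp Require Import all_boot all_order all_algebra.
From mathcomp Require Import all_fingroup all_solvable all_field.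
From mathcomp Require Import all_character.

(* The dessin of (G; x, y) is primitive iff H = <x> is maximal in G, and
   faithful iff H has trivial core. Being abelian, maximal and core-free, H is
   trivial or a Frobenius complement, so it has a normal complement K of coprime
   order. Maximality of H makes K minimal normal, and, H acting coprimely on K,
   elementary abelian. By Schur's lemma x acts on K as multiplication by an
   element a of a finite field F with additive group K; so G is the group of
   affine maps of F with slopes in S = <a>. Conversely, and to pin down the
   order of p modulo n = |S|, the group of scalings is maximal iff no proper
   nonzero additive subgroup W of F is stable under S. If F = F_(p^d) and n
   divides p^e - 1, the fixed field of t |-> t^(p^e) is such a W unless d <= e;
   in the other direction, the multipliers of a stable W form a subring of F of
   order p^e for some e with n dividing p^e - 1. *)

Set Implicit Arguments.
Unset Strict Implicit.
Unset Printing Implicit Defensive.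

Import GRing.Theory.
Local Open Scope group_scope.

(** * Point stabilisers in the left coset action *)

Section CosetAction.

Variable gT : finGroupType.
Implicit Types G H : {group gT}.

Lemma lmul_astab1 H : 'C[H : {set gT} | lmul_action gT] = H.
Proof.
apply/setP=> g; apply/astab1P/idP => /= [defH | Hg].
  rewrite -groupV; have: g^-1 \in lmul_set H g by apply: lcoset_refl.
  by rewrite defH.
by rewrite /lmul_set lcoset_id // groupV.
Qed.

Lemma lmul_orbit G H : orbit (lmul_action gT) G (H : {set gT}) = lcosets H G.
Proof.
apply/setP=> A.
apply/imsetP/imsetP=> -[g Gg ->]; exists g^-1; rewrite ?groupV //=.
  by rewrite /lmul_set lcosetE.
by rewrite /lmul_set invgK lcosetE.
Qed.

Lemma lmul_trans G H : [transitive G, on lcosets H G | lmul_action gT].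
Proof. by rewrite -lmul_orbit; apply: atrans_orbit. Qed.

Lemma mem_lcosets1 G H : (H : {set gT}) \in lcosets H G.
Proof. by rewrite -lmul_orbit; apply: orbit_refl. Qed.

Lemma card_lcosets_gt1 G H : (1 < #|lcosets H G|) = ~~ (G \subset H).
Proof.
by rewrite card_lcosets ltn_neqAle indexg_gt0 andbT eq_sym indexg_eq1.
Qed.

(** [<[x]>] is a point stabiliser of a transitive action. The degree condition removes the case
    [<[x]> = G], which [maximal_eq] admits. *)
Lemma primitive_dessinP G x :
  x \in G -> primitive_dessin G x <-> maximal <[x]> G.
Proof.
move=> Gx; have sHG: <[x]> \subset G by rewrite cycle_subG.
rewrite /primitive_dessin /black_vertices card_lcosets_gt1.
rewrite (trans_prim_astab (mem_lcosets1 _ _) (lmul_trans _ _)) lmul_astab1.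
rewrite (setIidPr sHG) /maximal_eq; split=> [[nsGH /predU1P[eqHG|//]] | maxH].
  by case/negP: nsGH; move/eqP: eqHG; rewrite eqEsubset => /andP[].
by split; [apply: proper_subn (maxgroupp maxH) | rewrite maxH orbT].
Qed.

(** The kernel of a transitive action is the core of a point stabiliser. *)
Lemma faithful_dessinP G x :
  x \in G -> faithful_dessin G x <-> gcore <[x]> G = 1.
Proof.
move=> Gx; have sHG: <[x]> \subset G by rewrite cycle_subG.
rewrite /faithful_dessin /black_vertices /faithful.
rewrite (astab_trans_gcore (lmul_trans _ _) (mem_lcosets1 _ _)) lmul_astab1.
rewrite (setIidPr (subset_trans (gcore_sub _ _) sHG)).
by split=> [/trivgP | ->].
Qed.

End CosetAction.

(** * Core-free maximal abelian subgroups and Frobenius complements *)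

Section MaximalCyclic.

Variables (gT : finGroupType) (G H : {group gT}).
Hypotheses (maxH : maximal H G) (abelH : abelian H) (coreH : gcore H G = 1).

Lemma corefree_normal_trivg (N : {group gT}) :
  N \subset H -> G \subset 'N(N) -> N :=: 1.
Proof. by move=> sNH nNG; apply/trivgP; rewrite -coreH gcore_max. Qed.

(* An element of H :&: H :^ g centralises both H and H :^ g, which generate G
   as soon as g is outside H. *)
Lemma maximal_abelian_Frobenius : H :!=: 1 -> [Frobenius G with complement H].
Proof.
move=> ntH; have [prHG maxHG] := maxgroupP maxH.
have sHG := proper_sub prHG.
rewrite /Frobenius_group_with_complement proper_neq //=.
apply/normedTI_memJ_P; split; rewrite ?setD_eq0 ?subG1 // => a g.
rewrite !inE => /andP[nta Ha] Gg; rewrite conjg_eq1 nta /=.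
apply/idP/idP=> [Hag | Hg]; last by rewrite groupJ.
apply: contraR nta => notHg.
have cHa: H \subset 'C[a] by rewrite sub_cent1 (subsetP abelH).
have cHga: H :^ g^-1 \subset 'C[a].
  rewrite -(conjgK g a) cent1J conjSg sub_cent1.
  exact: (subsetP abelH).
have defG: 'C_G[a] = G.
  have sHC: H \subset 'C_G[a] by rewrite subsetI sHG.
  (* Otherwise ['C_G[a] = H] contains [H :^ g^-1], so [g] normalises [H]; as [g] is outside [H],
     maximality makes [H] normal in [G], against its trivial core. *)
  have [// | neqCG] := eqVneq ('C_G[a] : {set gT}) G.
  have defH: 'C_G[a] = H by apply: maxHG; rewrite // properEneq neqCG subsetIl.
  have nHg: g^-1 \in 'N(H).
    rewrite inE -{2}defH subsetI cHga andbT.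
    by rewrite -(conjGid (groupVr Gg)) conjSg.
  have nHG: 'N_G(H) = G.
    apply/eqP; apply: contraR notHg => neqNG; rewrite -groupV.
    suffices <-: 'N_G(H) = H by rewrite inE groupV Gg.
    apply: maxHG; last by rewrite subsetI sHG normG.
    by rewrite properEneq neqNG subsetIl.
  have := corefree_normal_trivg (subxx H) (introT setIidPl nHG).
  by move/eqP; rewrite (negPf ntH).
have cGa: G \subset 'C[a] by apply/setIidPl.
have := @corefree_normal_trivg <[a]>%G.
rewrite cycle_subG Ha => /(_ isT) a1.
by rewrite -cycle_eq1 a1 // cents_norm // cent_cycle.
Qed.

(** The complement is the Frobenius kernel, except that for [H = 1], which is not a Frobenius
    complement, it is [G] itself. *)
Lemma maximal_abelian_complement :
  exists2 K : {group gT}, K ><| H = G & coprime #|K| #|H|.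
Proof.
have [H1 | ntH] := eqVneq (H : {set gT}) 1.
  by exists G; rewrite H1 ?sdprodg1 // cards1 coprimen1.
have [K frobG] := Frobenius_kernel_exists (maximal_abelian_Frobenius ntH).
exists K; last exact: Frobenius_coprime frobG.
by have [] := Frobenius_context frobG.
Qed.

End MaximalCyclic.

(** * Structure of the normal complement *)

Section Socle.

Variables (gT : finGroupType) (G H K : {group gT}).
Hypotheses (maxH : maximal H G) (abelH : abelian H) (coreH : gcore H G = 1).
Hypotheses (defG : K ><| H = G) (coKH : coprime #|K| #|H|).

(** For an [H]-invariant [L] properly inside [K], the group [L <*> H] is proper in [G], hence equal
    to [H], and so [L] lies in [K :&: H = 1]. *)
Lemma complement_minnormal : minnormal K H.
Proof.
have [[_ mulKH nKH tiKH] [prHG maxHG]] := (sdprodP defG, maxgroupP maxH).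
apply/mingroupP; split.
  rewrite nKH andbT; apply: contraTneq prHG => K1.
  by rewrite -mulKH K1 mul1g properxx.
move=> L /andP[ntL nLH] sLK; apply/eqP; rewrite eqEcard sLK leqNgt.
have tiLH: L :&: H = 1 by apply/trivgP; rewrite -tiKH setSI.
apply: contra ntL => ltLK.
have prLH: L <*> H \proper G.
  rewrite properEcard join_subG (subset_trans sLK) ?(proper_sub prHG) /=.
    rewrite norm_joinEr // -mulKH !TI_cardMg //.
    by rewrite ltn_pmul2r ?cardG_gt0.
  by rewrite -mulKH mulG_subl.
rewrite -subG1 -tiLH subsetIidl -(maxHG _ prLH) ?joing_subl //.
exact: joing_subr.
Qed.

(** Coprime action provides an [H]-invariant Sylow subgroup of [K], so by minimality [K] is a
    p-group; then ['Ohm_1('Z(K))], characteristic and nontrivial, is all of [K]. *)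
Lemma complement_abelem : exists2 p, prime p & p.-abelem K.
Proof.
have [/andP[ntK nKH] minK] := mingroupP complement_minnormal.
have p_pr: prime (pdiv #|K|) by rewrite pdiv_prime // cardG_gt1.
set p := pdiv #|K| in p_pr; exists p => //.
have [P sylP nPH] := sol_coprime_Sylow_exists p (abelian_sol abelH) nKH coKH.
have ntP: P :!=: 1.
  rewrite -cardG_gt1 (card_Hall sylP) p_part -[1%N](expn0 p).
  rewrite ltn_exp2l ?prime_gt1 // logn_gt0 mem_primes p_pr cardG_gt0.
  exact: pdiv_dvd.
have pK: p.-group K.
  by rewrite -(minK P _ (pHall_sub sylP)) ?(pHall_pgroup sylP) ?ntP.
have charL: 'Ohm_1('Z(K)) \char K by rewrite gFchar_trans ?gFchar.
rewrite -(minK 'Ohm_1('Z(K))%G) ?(char_sub charL) //=.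
  by rewrite Ohm1_abelem ?center_abelian // (pgroupS (center_sub K)).
rewrite (char_norm_trans charL) // andbT Ohm1_eq1.
by rewrite (center_nil_eq1 (pgroup_nil pK)).
Qed.

(** This centraliser is normalised by both [K] and [H], so it is a normal subgroup of [G] inside
    [H]. *)
Lemma complement_faithful : 'C_H(K) = 1.
Proof.
have [_ mulKH nKH _] := sdprodP defG.
apply: (corefree_normal_trivg coreH); first exact: subsetIl.
rewrite -mulKH mul_subG //; first by rewrite cents_norm // centsC subsetIr.
by rewrite normsI ?norms_cent ?normG.
Qed.

End Socle.

Import MatrixGenField.

(** * Schur's lemma and the field acting on the complement *)

Section FieldStructure.

Variables (gT : finGroupType) (K : {group gT}) (x : gT).

Lemma cyclic_minnormal_field p :
    p.-abelem K -> minnormal K <[x]> ->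
  exists (F : finFieldType) (a : {unit F}) (phi : F -> gT),
    [/\ injective phi, phi @: setT = K,
        {morph phi : u v / (u + v)%R >-> u * v}
      & {morph phi : u / (u * FinRing.uval a)%R >-> u ^ x}].
Proof.
move=> abelK minK; have [/andP[ntK nKH] _] := mingroupP minK.
pose rH := abelem_repr abelK ntK nKH.
have irrH: mx_irreducible rH by apply/abelem_mx_irrP.
have Hx := cycle_id x.
have cHA: centgmx rH (rH x).
  apply/centgmxP=> h Hh; rewrite -!repr_mxM //; congr (rH _).
  exact: (centsP (cycle_abelian x)).
(* This is the algebra generated by [rH x] over ['F_p], a field because [rH] is irreducible; [g] is
   [rH x] seen as an element of it. *)
pose F : finFieldType := gen_of irrH cHA.
pose g : F := groot irrH cHA.
have g_val: mxval g = rH x by apply: mxval_groot.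
have g_unit: g \is a GRing.unit.
  rewrite unitfE; apply/eqP=> g0; have := repr_mx_unit rH Hx.
  by rewrite -g_val g0 mxval0 unitr0.
have [v0 nz_v0]: exists v : 'rV['F_p](K), v != 0%R.
  exists (const_mx 1%R); apply/eqP/rowP=> /(_ 0%R)/eqP.
  by rewrite !mxE oner_eq0.
(* Applying field elements to a fixed nonzero vector identifies [F] with [K]; any [v0 != 0]
   serves. *)
pose phi (u : F) : gT := rVabelem abelK ntK (v0 *m mxval u).
have phiD: {morph phi : u v / (u + v)%R >-> u * v}.
  by move=> u v; rewrite /phi mxvalD mulmxDr rVabelemD.
have phiM: {morph phi : u / (u * g)%R >-> u ^ x}.
  by move=> u; rewrite /phi mxvalM mulmxA g_val rVabelemJ.
have phi_inj: injective phi.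
  move=> u v /rVabelem_inj/eqP; rewrite -subr_eq0 -mulmxBr -rmorphB /=.
  have [/eqP | nz_uv] := eqVneq (u - v)%R 0%R.
    by rewrite subr_eq0 => /eqP.
  move/eqP/(congr1 (mulmx^~ (mxval (u - v)^-1%R))).
  rewrite -mulmxA -mxvalM divff // mxval1 mulmx1 mul0mx.
  by move/eqP; rewrite (negPf nz_v0).
exists F, (FinRing.unit F g_unit), phi; split=> //.
have gL: group_set (phi @: setT).
  apply/group_setP; split.
    by apply/imsetP; exists 0%R; rewrite ?inE // /phi mxval0 mulmx0 rVabelem0.
  move=> _ _ /imsetP[u _ ->] /imsetP[v _ ->]; rewrite -phiD.
  by rewrite imset_f ?inE.
(* The image of [phi] is a nontrivial [<[x]>]-invariant subgroup of [K], so minimality gives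
   surjectivity. *)
have [_ minKH] := mingroupP minK.
rewrite -(minKH (Group gL)) //=; last first.
  by apply/subsetP=> _ /imsetP[u _ ->]; apply: mem_rVabelem.
apply/andP; split.
  apply/(trivgPn (Group gL)); exists (phi 1%R); first by rewrite imset_f ?inE.
  rewrite -(rVabelem0 abelK ntK) (inj_eq (@rVabelem_inj _ _ _ _ _)).
  by rewrite mxval1 mulmx1.
rewrite cycle_subG inE; apply/subsetP=> _ /imsetP[_ /imsetP[u _ ->] ->].
by rewrite -phiM imset_f ?inE.
Qed.

End FieldStructure.

(** * Affine groups of finite fields and their scalings *)

Section AffineGroup.

Variable F : finFieldType.
Implicit Types (a : {unit F}) (b u v : F) (W : {set F}) (S : {group {unit F}}).

Lemma affine_perm_inj a b a' b' :
  affine_perm a b = affine_perm a' b' -> a = a' /\ b = b'.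
Proof.
move=> /permP eq_ab; have := eq_ab 0%R.
rewrite !permE /affine_map !mulr0 !add0r.
move=> eq_b; have := eq_ab 1%R; rewrite !permE /affine_map !mulr1 eq_b.
by move/addIr => eq_a; split=> //; apply: val_inj.
Qed.

Lemma affine_permX a n : affine_perm a 0%R ^+ n = affine_perm (a ^+ n) 0%R.
Proof.
elim: n => [|n IHn]; first by rewrite !expg0 affine_perm1.
by rewrite expgS IHn affine_permM mulr0 add0r -expgSr.
Qed.

Lemma affine_permV a b :
  (affine_perm a b)^-1 = affine_perm a^-1 (- (FinRing.uval a^-1 * b))%R.
Proof.
apply: (mulgI (affine_perm a b)); rewrite mulgV affine_permM mulVg subrr.
exact/esym/affine_perm1.
Qed.

Lemma mem_scalings S a b :
  (affine_perm a b \in scalings S) = (a \in S) && (b == 0%R).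
Proof.
apply/imsetP/andP=> [[a' Sa' /affine_perm_inj[-> ->]] | [Sa /eqP->]] //.
by exists a.
Qed.

Lemma mem_affine S a b : (affine_perm a b \in affine_set S) = (a \in S).
Proof.
apply/imset2P/idP=> [[a' b' Sa' _ /affine_perm_inj[-> _]] // | Sa].
by exists a b; rewrite ?inE.
Qed.

Lemma scalings_group_set S : group_set (scalings S).
Proof.
apply/group_setP; split; first by rewrite -affine_perm1 mem_scalings group1 /=.
move=> _ _ /imsetP[a Sa ->] /imsetP[a' Sa' ->].
by rewrite affine_permM mem_scalings groupM //= mulr0 addr0.
Qed.
Canonical scalings_group S := Group (scalings_group_set S).

Lemma scalings_sub S : scalings S \subset affine_set S.
Proof. by apply/subsetP=> _ /imsetP[a Sa ->]; rewrite mem_affine. Qed.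

Lemma scalings_cycle a : scalings <[a]> = <[affine_perm a 0%R]>.
Proof.
apply/setP=> g; apply/imsetP/cycleP=> [[_ /cycleP[i ->] ->] | [i ->]].
  by exists i; rewrite affine_permX.
by exists (a ^+ i); rewrite ?mem_cycle ?affine_permX.
Qed.

Lemma gcore_scalings S : gcore (scalings S) (affine_set S) = 1.
Proof.
apply/trivgP/subsetP=> g core_g; rewrite inE.
have sub_core := subsetP (gcore_sub (scalings S) (affine_group S)).
have /imsetP[a Sa def_g] := sub_core g core_g.
have At: affine_perm 1 1%R \in affine_group S by rewrite mem_affine.
(* Conjugating [t |-> a t] by [t |-> t + 1] gives the constant term [1 - a], which must vanish. *)
have: g ^ affine_perm 1 1%R \in scalings S.
  apply: sub_core; rewrite memJ_norm //.
  exact: subsetP (gcore_norm (scalings S) (affine_group S)) _ At.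
rewrite def_g conjgE affine_permV !affine_permM mem_scalings !invg1 mulg1 mul1g.
case/andP=> _; rewrite mulr0 add0r !mulr1 mulrN mulr1 addrC subr_eq0 => /eqP a1.
suffices ->: a = 1 by rewrite affine_perm1.
by apply: val_inj; rewrite /= a1.
Qed.

(** As [F] is finite, these are exactly its additive subgroups. *)
Definition additive_set W := 0%R \in W /\ {in W &, forall u v, (u + v)%R \in W}.

(** The additive group of [F] is an irreducible [S]-module. *)
Definition scaling_irreducible S := forall W, additive_set W ->
  (forall a u, a \in S -> u \in W -> (FinRing.uval a * u)%R \in W) ->
  W = [set 0%R] \/ W = [set: F].

(** Groups [M] between the scalings and the affine group correspond to [S]-stable additive subgroups
    [W], the sets of translations in [M]. *)
Lemma maximal_scalings S :
  maximal (scalings S) (affine_set S) <-> scaling_irreducible S.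
Proof.
split=> [maxS W [W0 WD] WM | irrS].
  pose M := [set affine_perm a b | a in S, b in W].
  have memM a b : (affine_perm a b \in M) = (a \in S) && (b \in W).
    apply/imset2P/andP=> [[a' b' Sa' Wb' /affine_perm_inj[-> ->]] // | []].
    by exists a b.
  have gM: group_set M.
    apply/group_setP; split; first by rewrite -affine_perm1 memM group1.
    move=> _ _ /imset2P[a b Sa Wb ->] /imset2P[a' b' Sa' Wb' ->].
    by rewrite affine_permM memM groupM //= WD ?WM.
  have [_ maxM] := maxgroupP maxS.
  have sSM: scalings S \subset M.
    by apply/subsetP=> _ /imsetP[a Sa ->]; rewrite memM Sa.
  have sMA: M \subset affine_set S.
    by apply/subsetP=> _ /imset2P[a b Sa Wb ->]; rewrite mem_affine.
  have [eqMA | neqMA] := eqVneq M (affine_set S).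
    right; apply/setP=> b; rewrite inE.
    have: affine_perm 1 b \in M by rewrite eqMA mem_affine.
    by rewrite memM => /andP[].
  left; apply/setP=> b; rewrite inE.
  have := memM 1 b; rewrite [M](maxM (Group gM)) //.
    by rewrite mem_scalings group1.
  by rewrite properEneq neqMA.
apply/maxgroupP; split.
  rewrite properE scalings_sub; apply/subsetPn; exists (affine_perm 1 1%R).
    by rewrite mem_affine.
  by rewrite mem_scalings oner_eq0 andbF.
move=> M prMA sSM; have sMA := proper_sub prMA.
pose W := [set b | affine_perm 1 b \in M].
(* Since [M] contains the scalings, only the constant term [b] decides membership. *)
have sM a b : a \in S -> (affine_perm a b \in M) = (b \in W).
  move=> Sa; have Ma: affine_perm a 0%R \in M.
    by rewrite (subsetP sSM) // mem_scalings Sa /=.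
  by rewrite inE -[in RHS](groupMl _ Ma) affine_permM mul1g mulr0 add0r.
have addW: additive_set W.
  split=> [|u v]; rewrite !inE ?affine_perm1 ?group1 // => Mu Mv.
  by have := groupM Mu Mv; rewrite affine_permM mulg1 mul1r.
have [a u Sa Wu | W0 | WT] := irrS W addW.
- rewrite inE in Wu; rewrite -(sM a) // -[a in affine_perm a]mulg1.
  rewrite -[X in affine_perm _ X]addr0 -affine_permM groupM //.
  by rewrite (subsetP sSM) // mem_scalings Sa /=.
- apply/eqP; rewrite eqEsubset sSM andbT; apply/subsetP=> g Mg.
  have /imset2P[a b Sa _ def_g] := subsetP sMA g Mg.
  by move: Mg; rewrite def_g sM // W0 mem_scalings Sa inE.
case/negP: (proper_subn prMA); apply/subsetP=> _ /imset2P[a b Sa _ ->].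
by rewrite sM // WT inE.
Qed.

End AffineGroup.

(** * Multiplicative order and irreducibility *)

Lemma unit_expg_eq1 (R : finUnitRingType) (u : {unit R}) e :
  (u ^+ e == 1) = (FinRing.uval u ^+ e == 1)%R.
Proof.
have valX : FinRing.uval (u ^+ e) = (FinRing.uval u ^+ e)%R.
  exact: FinRing.val_unitX.
by rewrite -valX; apply/eqP/eqP => [-> // | ue1]; apply: val_inj.
Qed.

(** Both sides say that [d] is the least positive exponent [e] with [p ^ e = 1] modulo [n]. For
    [n <= 1] the type ['Z_n] would be the integers modulo 2. *)
Lemma has_mult_order_modP n p d : 1 < n -> 0 < p -> 0 < d -> n %| (p ^ d).-1 ->
  has_mult_order_mod n p d <-> (forall e, 0 < e -> n %| (p ^ e).-1 -> d <= e).
Proof.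
move=> n_gt1 p_gt0 d_gt0 dvd_d.
have dvdE e : (n %| (p ^ e).-1) = ((p%:R : 'Z_n) ^+ e == 1)%R.
  have pe_gt0: 0 < p ^ e by rewrite expn_gt0 p_gt0.
  have valE k : val (k%:R : 'Z_n)%R = k %% n by apply: val_Zp_nat.
  by rewrite -natrX -[1%R]/(1%:R)%R -val_eqE !valE eqn_mod_dvd // subn1.
have uX (u : {unit 'Z_n}) e :
    FinRing.uval u = p%:R%R -> (n %| (p ^ e).-1) = (#[u] %| e).
  by move=> def_u; rewrite dvdE -def_u order_dvdn unit_expg_eq1.
split=> [[u def_u <-] e e_gt0 | min_d].
  by rewrite (uX u) //; apply: dvdn_leq.
have Up: (p%:R : 'Z_n)%R \is a GRing.unit.
  rewrite -(unitrX_pos _ d_gt0); move: dvd_d; rewrite dvdE => /eqP->.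
  exact: unitr1.
exists (FinRing.unit 'Z_n Up) => //; apply/eqP; rewrite eqn_leq.
rewrite dvdn_leq -?uX //= min_d ?order_gt0 // (uX (FinRing.unit 'Z_n Up)) //.
Qed.

Section MultOrder.

Variables (F : finFieldType) (S : {group {unit F}}) (p d : nat).
Hypotheses (p_pr : prime p) (oF : #|F| = (p ^ d)%N).
Implicit Types (W : {set F}).

Let p_gt0 : 0 < p := prime_gt0 p_pr.
Let p_gt1 : 1 < p := prime_gt1 p_pr.

Let oUF : #|[set: {unit F}]| = (p ^ d).-1.
Proof. by rewrite card_finField_unit oF. Qed.

Lemma card_additive_set W :
  additive_set W -> exists2 e, e <= d & #|W| = (p ^ e)%N.
Proof.
case=> W0 WD; have gW: group_set (W : {set F}) by apply/group_setP.
apply/dvdn_pfactor => //; rewrite -oF -cardsT.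
exact: cardSg (subsetT (Group gW)).
Qed.

Lemma scaling_irreducibleP :
  scaling_irreducible S <-> (forall e, 0 < e -> #|S| %| (p ^ e).-1 -> d <= e).
Proof.
split=> [irrS e e_gt0 dvdS | min_d W addW WM].
  have pcharF := card_finPcharP oF p_pr.
  have pe_gt0: 0 < p ^ e by rewrite expn_gt0 p_gt0.
  pose W := [set t : F | t ^+ (p ^ e) == t]%R.
  have addW: additive_set W.
    split=> [|u v]; rewrite !inE; first by rewrite expr0n (gtn_eqF pe_gt0).
    move=> /eqP Wu /eqP Wv; rewrite exprDn_pchar ?Wu ?Wv //.
    by rewrite pnatX pnatE // pcharF.
  have [a u Sa | W0 | WT] := irrS W addW.
  - rewrite !inE exprMn => /eqP->.
    have /eqP a1: (FinRing.uval a ^+ (p ^ e).-1 == 1)%R.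
      by rewrite -unit_expg_eq1 -order_dvdn (dvdn_trans _ dvdS) ?order_dvdG.
    by rewrite -(prednK pe_gt0) exprS a1 mulr1.
  - by have := in_set1 (1%R : F) 0%R; rewrite -W0 inE expr1n eqxx oner_eq0.
  (* If [W] is all of [F], a generator of the unit group has order [p ^ d - 1] dividing
     [p ^ e - 1]. *)
  have /cyclicP[g defU]: cyclic [set: {unit F}].
    exact: field_unit_group_cyclic.
  have: #[g] %| (p ^ e).-1.
    rewrite order_dvdn unit_expg_eq1.
    have: FinRing.uval g \in W by rewrite WT inE.
    rewrite inE -{1}(prednK pe_gt0) exprS => /eqP gpe.
    by rewrite -(inj_eq (mulrI (valP g))) gpe mulr1.
  rewrite orderE -defU oUF => /dvdn_leq le_pd.
  have pe_gt1: 1 < p ^ e by rewrite -(ltn_exp2l 0 e p_gt1) in e_gt0.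
  have pd_gt0: 0 < p ^ d by rewrite expn_gt0 p_gt0.
  rewrite -(leq_exp2l _ _ p_gt1) -(prednK pe_gt0) -(prednK pd_gt0).
  rewrite ltnS le_pd //.
  by rewrite -ltnS prednK.
pose R := [set r : F | [forall w in W, (r * w)%R \in W]].
have memR r : reflect (forall w, w \in W -> (r * w)%R \in W) (r \in R).
  by rewrite inE; apply: forall_inP.
have addR: additive_set R.
  have [W0 WD] := addW; split=> [|r s /memR Rr /memR Rs].
    by apply/memR=> w _; rewrite mul0r.
  by apply/memR=> w Ww; rewrite mulrDl WD ?Rr ?Rs.
have R1: 1%R \in R by apply/memR=> w; rewrite mul1r.
have [e le_ed oR] := card_additive_set addR.
pose RU := [set a : {unit F} | FinRing.uval a \in R].
have memRU a: (a \in RU) = (FinRing.uval a \in R) by rewrite in_set.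
have gRU: group_set RU.
  apply/group_setP; split=> [|a b]; rewrite !memRU // => /memR Ra /memR Rb.
  by apply/memR=> w Ww; rewrite -mulrA Ra ?Rb.
have oRU: #|RU| = (p ^ e).-1.
  (* Every nonzero element of [R] is a unit of [F], so [RU] is [R] without zero. *)
  rewrite -oR (cardsD1 0%R R) (proj1 addR) /= -(card_imset _ (@val_inj _ _ _)).
  apply: eq_card => r; rewrite in_setD1.
  apply/imsetP/andP=> [[a RUa ->] | [nz_r Rr]].
    by rewrite -unitfE (valP a) -memRU.
  have Ur: r \is a GRing.unit by rewrite unitfE.
  by exists (FinRing.unit F Ur); rewrite ?memRU.
have sSR: S \subset RU.
  by apply/subsetP=> a Sa; rewrite memRU; apply/memR=> w; apply: WM.
have e_gt0: 0 < e.
  rewrite -(ltn_exp2l _ _ p_gt1) -oR expn0 (cardsD1 0%R) (proj1 addR) ltnS.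
  by rewrite card_gt0; apply/set0Pn; exists 1%R; rewrite in_setD1 oner_eq0.
have le_de: d <= e by apply: min_d; rewrite // -oRU (@cardSg _ (Group gRU) S).
have RT: R = setT.
  by apply/eqP; rewrite eqEcard subsetT cardsT oF oR leq_exp2l.
(* Now [W] is an ideal of the field [F]: a nonzero [w] in it yields every [t = (t / w) * w]. *)
have [sW0 | /subsetPn[w Ww nz_w]] := boolP (W \subset [set 0%R]).
  by left; apply/eqP; rewrite eqEsubset sW0 sub1set (proj1 addW).
rewrite in_set1 in nz_w.
right; apply/setP=> t; rewrite inE -(mulfVK nz_w t).
by apply/memR; rewrite // RT inE.
Qed.

End MultOrder.

(** For [#|S| = 1] the divisibility always holds, and [e = 1] forces [d = 1]; for larger [S] the
    criterion is the minimality of [d]. *)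
Lemma scaling_irreducible_mult_order
    (F : finFieldType) (S : {group {unit F}}) p d :
    prime p -> 0 < d -> #|F| = (p ^ d)%N ->
  (#|S| = 1%N /\ d = 1%N) \/ (1 < #|S| /\ has_mult_order_mod #|S| p d)
    <-> scaling_irreducible S.
Proof.
move=> p_pr d_gt0 oF.
apply: iff_trans (iff_sym (scaling_irreducibleP S p_pr oF)).
have dvdS: #|S| %| (p ^ d).-1.
  by rewrite -oF -card_finField_unit cardSg ?subsetT.
have [S_gt1 | S_le1] := ltnP 1 #|S|.
  apply: iff_trans (has_mult_order_modP S_gt1 (prime_gt0 p_pr) d_gt0 dvdS).
  by split=> [[[S1]|[]] // | ]; [rewrite S1 in S_gt1 | right].
have S1: #|S| = 1%N by apply/eqP; rewrite eqn_leq S_le1 cardG_gt0.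
rewrite S1; split=> [[[_ ->] // | []//] | min_d]; left; split=> //.
by apply/eqP; rewrite eqn_leq d_gt0 min_d.
Qed.

(** * Identification of the group with an affine group *)

Section AffineEmbedding.

Variables (gT : finGroupType) (G K : {group gT}) (x : gT).
Hypotheses (defG : K ><| <[x]> = G) (faithK : 'C_<[x]>(K) = 1).
Variables (F : finFieldType) (a : {unit F}) (phi : F -> gT).
Hypotheses (phi_inj : injective phi) (im_phi : phi @: setT = K).
Hypothesis phiD : {morph phi : u v / (u + v)%R >-> u * v}.
Hypothesis phiM : {morph phi : u / (u * FinRing.uval a)%R >-> u ^ x}.

(** Sending [phi u] to the translation by [u] and [x] to the scaling by [a] respects conjugation by
    [phiM], so the two maps glue on the semidirect product. *)
Lemma isom_affine_group : exists f : {morphism G >-> {perm F}},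
  isom G (affine_group <[a]>) f /\ f x = affine_perm a 0%R.
Proof.
have phiMX i u : phi (u * FinRing.uval (a ^+ i))%R = phi u ^ (x ^+ i).
  elim: i => [|i IHi]; first by rewrite !expg0 conjg1 mulr1.
  by rewrite !expgSr conjgM -IHi -phiM mulrA.
have Kphi u : phi u \in K by rewrite -im_phi imset_f ?inE.
have Kex k : k \in K -> exists u, k = phi u.
  by rewrite -im_phi => /imsetP[u _ ->]; exists u.
(* Faithfulness on [K] gives [x] and [a] the same order, making the map on [<[x]>] well defined and
   injective. *)
have o_xa i : (x ^+ i == 1) = (a ^+ i == 1).
  apply/eqP/eqP=> [xi1 | ai1].
    apply: val_inj; apply: phi_inj.
    by rewrite -[X in phi X]mul1r phiMX xi1 conjg1.
  apply/set1P; rewrite -[[set 1]]faithK inE mem_cycle /=.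
  apply/centP=> _ /Kex[u ->].
  by apply/esym/commgP/conjg_fixP; rewrite -phiMX ai1 mulr1.
have dvd_ax: #[affine_perm a 0%R] %| #[x].
  have /eqP ax1: a ^+ #[x] == 1 by rewrite -o_xa expg_order.
  by rewrite order_dvdn affine_permX ax1 affine_perm1.
(* The inverse of [phi] on [K], with default value 0 elsewhere. *)
pose psi k := odflt 0%R [pick u | phi u == k].
have phiK: cancel phi psi.
  rewrite /psi => u; case: pickP => [v /eqP/phi_inj // | /(_ u)].
  by rewrite eqxx.
have psiM: {in K &, {morph psi : k l / k * l >-> (k + l)%R}}.
  by move=> _ _ /Kex[u ->] /Kex[v ->]; rewrite -phiD !phiK.
have fK_M: {in K &, {morph (fun k => affine_perm 1 (psi k)) : k l / k * l}}.
  by move=> k l Kk Kl; rewrite /= affine_permM mulg1 mul1r psiM.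
pose fK := Morphism fK_M; pose fH := eltm_morphism dvd_ax.
have actf: {in K & <[x]>, morph_act 'J 'J fK fH}.
  move=> _ _ /Kex[u ->] /cycleP[i ->].
  apply: (mulgI (fH (x ^+ i))); rewrite /= -conjgC eltmE affine_permX.
  rewrite -phiMX !phiK !affine_permM mulg1 mul1g mulr0 add0r addr0.
  by congr affine_perm; apply: mulrC.
pose f := sdprodm_morphism defG actf; exists f.
have Hx := cycle_id x.
have fx: f x = affine_perm a 0%R by rewrite /= sdprodmEr //= eltm_id.
have im_fH: fH @* <[x]> = scalings <[a]>.
  by rewrite morphim_cycle //= eltm_id scalings_cycle.
split=> //; apply/isomP; split.
  rewrite injm_sdprodm injm_eltm im_fH; apply/and3P; split.
  - apply/injmP=> _ _ /Kex[u ->] /Kex[v ->] /=.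
    by rewrite !phiK => /affine_perm_inj[_ ->].
  - have := expg_order (affine_perm a 0%R).
    rewrite affine_permX -affine_perm1 => /affine_perm_inj[an1 _].
    by rewrite order_dvdn o_xa an1.
  rewrite -subG1; apply/subsetP=> g /setIP[/morphimP[k _ Kk ->] /=].
  by rewrite mem_scalings group1 inE => /eqP->; rewrite affine_perm1.
rewrite im_sdprodm im_fH; apply/eqP; rewrite eqEsubset; apply/andP; split.
  rewrite (mul_subG (G := affine_group <[a]>)) ?scalings_sub //.
  by apply/subsetP=> _ /morphimP[k _ Kk ->] /=; rewrite mem_affine.
apply/subsetP=> _ /imset2P[c b Sc _ ->].
(* Composition runs left to right: the translation comes first, so its constant is divided by
   [c]. *)
have ->: affine_perm c b =
    affine_perm 1 (FinRing.uval c^-1 * b)%R * affine_perm c 0%R.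
  by rewrite affine_permM mulg1 addr0 /= mulVKr //; apply: valP.
rewrite mem_mulg ?mem_scalings ?Sc ?eqxx //.
rewrite -[X in affine_perm 1 X]phiK.
by apply: (mem_morphim fK); apply: Kphi.
Qed.

End AffineEmbedding.

Theorem theorem1p1 (gT : finGroupType) (G : {group gT}) (x y : gT)
    (hD : regular_dessin G x y) :
  primitive_dessin G x /\ faithful_dessin G x <-> is_generalised_Paley G x y.
Proof.
have [Gx Gy]: x \in G /\ y \in G.
  by rewrite -hD !mem_gen // !inE eqxx ?orbT.
have sHG: <[x]> \subset G by rewrite cycle_subG.
split=> [[/(primitive_dessinP Gx) maxH /(faithful_dessinP Gx) coreH] | ].
  have abelH := cycle_abelian x.
  have [K defG coKH] := maximal_abelian_complement maxH abelH coreH.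
  have minK := complement_minnormal maxH defG.
  have [q _ abelK] := complement_abelem maxH abelH defG coKH.
  have [F [a [phi [phi_inj im_phi phiD phiM]]]] :=
    cyclic_minnormal_field abelK minK.
  have faithK := complement_faithful coreH defG.
  have [f [isof fx]] := isom_affine_group defG faithK phi_inj im_phi phiD phiM.
  have [injf imfG] := isomP isof.
  have imf: f @* G = affine_set <[a]> by [].
  have [p p_pr pcharF] := finPcharP F.
  have [d oF] : {d | #|F| = (p ^ d)%N}.
    apply: p_natP; rewrite -cardsT.
    exact: abelem_pgroup (fin_ring_pchar_abelem pcharF).
  have d_gt0: 0 < d.
    rewrite lt0n; apply: contraTneq (finNzRing_gt1 F) => d0.
    by rewrite oF d0.
  have imH: f @* <[x]> = scalings <[a]>.
    by rewrite morphim_cycle // fx scalings_cycle.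
  have irrS: scaling_irreducible <[a]>.
    by apply/maximal_scalings; rewrite -imH -imf injm_maximal.
  exists p, d, #[a], F, <[a]>%G, (f x), (f y); split; last first.
    by exists f.
  split=> //; split.
  - exact/(scaling_irreducible_mult_order <[a]> p_pr d_gt0 oF).
  - by rewrite /generator fx scalings_cycle.
  have Gfy: f y \in affine_group <[a]>.
    by have := mem_morphim f Gy Gy; rewrite imf.
  rewrite in_setD Gfy andbT -imH.
  (* Otherwise [y] would lie in [<[x]>], which would then contain the generators of [G]. *)
  apply/negP=> /morphimP[h Gh Hh /(injmP injf _ _ Gy Gh) eq_yh].
  have := proper_subn (maxgroupp maxH); rewrite -hD gen_subG subUset !sub1set.
  by rewrite cycle_id eq_yh Hh.
case=> p [d [n [F [S [x' [y' [[[p_pr d_gt0 oF oS] [ordS genx Gy']]]]]]]]].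
case=> f [isof fx fy]; have [injf imfG] := isomP isof.
have imf: f @* G = affine_set S by [].
have imH: f @* <[x]> = scalings S.
  by rewrite morphim_cycle // fx; apply/esym/eqP.
split.
  apply/(primitive_dessinP Gx).
  rewrite -(injm_maximal injf) // imH imf; apply/maximal_scalings.
  by apply/(scaling_irreducible_mult_order _ p_pr d_gt0 oF); rewrite oS.
apply/(faithful_dessinP Gx)/trivgP.
(* The image of the core is a normal subgroup of the affine group inside the scalings, whose core is
   trivial. *)
rewrite -(injmSK injf); last exact: subset_trans (gcore_sub _ _) _.
rewrite morphim1 -(gcore_scalings S) -imH -imf.
apply: gcore_max; first by rewrite morphimS ?gcore_sub.
exact: subset_trans (morphimS _ (gcore_norm _ _)) (morphim_norm _ _).
Qed.
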